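(* For integers $n\ge m\ge1$ define $$\xi_m^\star(n)=\max\Big\{\xi\in\{1,\dots,n\}:\sum_{k=0}^{\xi-1}\binom nk\le2^{n-m}\Big\}.$$ Then for every fixed integer $M\ge1$, $$\lim_{N\to\infty}\frac{\xi_M^\star(N)}{\xi_1^\star(\lfloor N/M\rfloor)}=M.$$
   Context: $\xi_M^\star(N)$ is the low-temperature cooling factor of the optimal joint protocol cooling $M$ out of $N$ identical thermal qubits, and $\xi_1^\star(\lfloor N/M\rfloor)$ that of $M$ parallel single-target protocols on groups of $\lfloor N/M\rfloor$ qubits. *)

(* Defs.v *)
From mathcomp Require Import all_boot all_order all_algebra.
From mathcomp Require Import all_classical all_reals all_analysis.

Set Implicit Arguments.
Unset Strict Implicit.
Unset Printing Implicit Defensive.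

(* xi ranges over {1, ..., n}. For 1 <= m <= n the set being maximised over
   contains 1, so the default value 0 of \max is never the result; for n < m
   (outside the intended domain) n - m is truncated and the value is junk. *)
Definition xi_star (m n : nat) : nat :=
  \max_(1 <= xi < n.+1 | \sum_(0 <= k < xi) 'C(n, k) <= 2 ^ (n - m)) xi.

(* Main.v *)
(** Both [xi_star M N] and [xi_star 1 n] are half of their second argument, up to
    [O(sqrt n)]. The symmetry of the binomial coefficients shows that more than
    [(n + 1) / 2] of them sum to more than [2 ^ n.-1]; conversely Chebyshev's
    inequality, from the second moment [\sum_k (n - 2 k)^2 'C(n, k) = n 2^n],
    shows that the first [j] of them sum to at most [2 ^ (n - m)] as soon as
    [n 2^m <= (n - 2 j)^2]. *)
Require Import Defs.
From mathcomp Require Import all_boot all_order all_algebra.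
From mathcomp Require Import all_classical all_reals all_analysis.
From mathcomp Require Import zify ring lra.
Import Order.TTheory GRing.Theory Num.Theory.
Import numFieldNormedType.Exports.
Local Open Scope classical_set_scope.
Local Open Scope ring_scope.

Lemma sum_bin (n : nat) : (\sum_(0 <= k < n.+1) 'C(n, k) = 2 ^ n)%N.
Proof.
rewrite -[2%N]/(1 + 1)%N expnDn big_mkord; apply: eq_bigr => i _.
by rewrite !exp1n !muln1.
Qed.

(** Pascal's rule under a weight [f]; it drives the induction for the second moment. *)
Lemma sum_binS (R : nzRingType) (n : nat) (f : nat -> R) :
  \sum_(0 <= k < n.+2) 'C(n.+1, k)%:R * f k =
  \sum_(0 <= k < n.+1) 'C(n, k)%:R * (f k + f k.+1).
Proof.
rewrite big_nat_recl // bin0.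
under eq_bigr do rewrite binS natrD mulrDl.
under [RHS]eq_bigr do rewrite mulrDr.
rewrite !big_split /= addrA; congr (_ + _).
rewrite [RHS]big_nat_recl // bin0; congr (_ + _).
by rewrite big_nat_recr //= bin_small // mul0r addr0.
Qed.

Lemma second_moment_bin (R : comNzRingType) (n : nat) :
  \sum_(0 <= k < n.+1) 'C(n, k)%:R * (n%:R - 2 * k%:R) ^+ 2
    = n%:R * 2 ^+ n :> R.
Proof.
elim: n => [|n IHn]; first by rewrite big_nat1 mulr0 subrr expr0n mulr0 mul0r.
rewrite sum_binS.
(* With [a = n - 2 * k], this is [(a + 1)^2 + (a - 1)^2 = 2 * a^2 + 2]. *)
pose F k : R := 2 * ('C(n, k)%:R * (n%:R - 2 * k%:R) ^+ 2) + 2 * 'C(n, k)%:R.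
rewrite (eq_bigr F) => [|k _]; last first.
  by rewrite /F -(natr1 n) -(natr1 k); ring.
rewrite big_split /= -!mulr_sumr IHn -natr_sum sum_bin natrX -(natr1 n) exprS.
ring.
Qed.

Lemma chebyshev_bin (n j : nat) : (j.*2 <= n)%N ->
  ((n - j.*2) ^ 2 * \sum_(0 <= k < j) 'C(n, k) <= n * 2 ^ n)%N.
Proof.
move=> jn; rewrite -(ler_nat int) !natrM natrX -second_moment_bin -expr2.
rewrite (@big_cat_nat _ _ _ j 0 n.+1) //=; last by lia.
(* The terms [k >= j] are dropped; for [k < j], [n - 2 * k >= n - 2 * j >= 0]. *)
rewrite natr_sum mulr_sumr -[leLHS]addr0 lerD //; last first.
  by apply: sumr_ge0 => k _; rewrite mulr_ge0 ?ler0n ?sqr_ge0.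
rewrite !big_nat; apply: ler_sum => k /andP[_ kj].
rewrite mulrC ler_wpM2l ?ler0n // ler_sqr ?nnegrE ?ler0n //; lia.
Qed.

Lemma leq_xi_star (m n j : nat) : (m <= n)%N -> (j.*2 <= n)%N ->
  (0 < n)%N -> (n * 2 ^ m <= (n - j.*2) ^ 2)%N -> (j <= xi_star m n)%N.
Proof.
move=> mn jn n0 njm; have [->//|j0] := posnP j.
rewrite /xi_star; apply: leq_bigmax_seq => //.
  by rewrite mem_index_iota; lia.
have := chebyshev_bin _ _ jn; set S := (\sum_(0 <= k < j) _)%N => cheb.
(* This factor turns the bound [2 ^ (n - m)] into the Chebyshev bound [n * 2 ^ n]. *)
rewrite -(@leq_pmul2l (n * 2 ^ m)) ?muln_gt0 ?n0 ?expn_gt0 //.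
rewrite -[leqRHS]mulnA -expnD subnKC //.
by apply: leq_trans cheb; rewrite leq_mul2r njm orbT.
Qed.

Lemma xi_star_leq (m n : nat) : (0 < m)%N -> ((xi_star m n).*2 <= n.+1)%N.
Proof.
move=> m0; suff: (xi_star m n <= n.+1./2)%N by lia.
apply/bigmax_leqP_seq => i; rewrite mem_index_iota => /andP[i0 lin] le_sum.
rewrite leqNgt; apply/negP => ni.
have n0 : (0 < n)%N by lia.
have le2 : ((\sum_(0 <= k < i) 'C(n, k)).*2 <= 2 ^ n)%N.
  rewrite -[in leqRHS](prednK n0) expnS mul2n leq_double; apply: leq_trans le_sum _.
  by rewrite leq_exp2l //; lia.
have := sum_bin n; rewrite (@big_cat_nat _ _ _ i) //=; last by lia.
(* The reflection [k -> n - k] carries the tail onto the first [n + 1 - i] indices, all below [i]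
   since [n + 1 < 2 * i]. *)
have -> : (\sum_(i <= k < n.+1) 'C(n, k) =
           \sum_(0 <= k < n.+1 - i) 'C(n, k))%N.
  rewrite -{1}[i]add0n big_addn big_nat_rev /= !big_nat.
  apply: eq_bigr => k /andP[_ kn]; rewrite -[RHS]bin_sub; last by lia.
  by congr 'C(_, _); lia.
move: le2; rewrite (@big_cat_nat _ _ _ (n.+1 - i) 0 i) //=; last by lia.
rewrite [X in (_ + X)%N]big_ltn; last by lia.
(* Index [n + 1 - i] lies below [i] but outside the reflected tail, so the first [i] coefficients
   exceed half the total strictly. *)
have : (0 < 'C(n, n.+1 - i))%N by rewrite bin_gt0; lia.
lia.
Qed.

(** Divided by [q * n], the bound reads [1 <= 2 * xi / n + 1 / q + 2 / n]. It comes from a [j] with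
    [n - 2 * j] just above [n / q]: then [(n - 2 * j)^2 >= (n / q)^2 >= n * 2 ^ m]. *)
Lemma xi_star_geq (m n q : nat) : (0 < q)%N -> (m < n)%N ->
  (q ^ 2 * 2 ^ m <= n)%N -> (q * n <= q * (xi_star m n).*2 + n + q.*2)%N.
Proof.
move=> q0 mn qn; have : (n < q * (n %/ q).+1)%N by rewrite mulnC ltn_ceil.
have : (q * (n %/ q) <= n)%N by rewrite mulnC leq_trunc_div.
move: (n %/ q)%N => d dn nd.
have [nd1|ltdn] := leqP n d.+1; first by nia.
(* The largest [j] with [n - 2 * j > d]; parity leaves [n - 2 * j] equal to [d + 1] or [d + 2]. *)
have [j [jn jd nj]] : exists j, [/\ j.*2 <= n, d < n - j.*2 & n <= j.*2 + d + 2]%N.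
  by exists (n - d.+1)./2; split; lia.
have jxi : (j <= xi_star m n)%N.
  apply: leq_xi_star => //; [exact: ltnW|exact: leq_trans mn|].
  have le1 : (d.+1 ^ 2 <= (n - j.*2) ^ 2)%N by rewrite leq_sqr.
  apply: leq_trans le1.
  rewrite -(@leq_pmul2l (q ^ 2)) ?expn_gt0 ?q0 // -expnMn.
  apply: (@leq_trans (n ^ 2)%N); last by rewrite leq_sqr ltnW.
  by rewrite mulnCA -mulnn leq_mul2l qn orbT.
nia.
Qed.

Lemma cvg_xi_star_div (R : realType) (m : nat) : (0 < m)%N ->
  ((xi_star m n)%:R / n%:R : R) @[n --> \oo] --> (2^-1 : R).
Proof.
move=> m0; apply/cvgrPdist_le => e e0.
(* Here [1 / q <= e]. Once [n >= 2 * q], also [2 / n <= 1 / q], so the lower bound gives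
   [1 / 2 - xi / n <= 1 / q <= e]. *)
pose q := (Num.truncn e^-1).+1.
have q0 : (0 < q)%N by [].
have qe : 1 <= q%:R * e.
  by rewrite -ler_pdivrMr // div1r ltW // truncnS_gt.
near=> n.
have n0 : (0 < n)%N by near: n; exact: nbhs_infty_gt.
have n0R : 0 < n%:R :> R by rewrite ltr0n.
have qn : q.*2%:R <= n%:R :> R by rewrite ler_nat; near: n; exact: nbhs_infty_ge.
have up : (xi_star m n)%:R * 2 <= n%:R + 1 :> R.
  by rewrite -natrM natr1 ler_nat muln2 xi_star_leq.
have lo : q%:R * n%:R <= q%:R * ((xi_star m n)%:R * 2) + n%:R + q.*2%:R :> R.
  rewrite -!natrM -!natrD ler_nat muln2; apply: xi_star_geq => //.
  - by near: n; exact: nbhs_infty_gt.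
  - by near: n; exact: nbhs_infty_ge.
have q1 : 1 <= q%:R :> R by rewrite ler1n.
have ne : n%:R <= q%:R * (n%:R * e) :> R.
  by rewrite mulrCA ler_peMr // ltW.
have qq : q%:R * 2 <= n%:R :> R by rewrite -natrM muln2.
rewrite (_ : _ - _ = (n%:R - (xi_star m n)%:R * 2) / (2 * n%:R)); last first.
  by field; rewrite gt_eqF.
rewrite normrM normfV (gtr0_norm (_ : 0 < 2 * n%:R)) ?mulr_gt0 //.
rewrite ler_pdivrMr ?mulr_gt0 // ler_norml.
have qp : 0 < q%:R :> R by rewrite ltr0n.
apply/andP; split.
- have : 1 <= n%:R * e.
    rewrite -(ler_pM2l qp) mulr1; apply: le_trans ne; lra.
  lra.
- rewrite -(ler_pM2l qp) mulrBr.
  rewrite -muln2 natrM in lo.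
  lra.
Unshelve. all: by end_near.
Qed.

Lemma cvg_divn_infty (M : nat) : (0 < M)%N -> (N %/ M)%N @[N --> \oo] --> \oo.
Proof.
move=> M0; apply/cvgnyPge => A; near=> N.
rewrite leq_divRL //; near: N; exact: nbhs_infty_ge.
Unshelve. all: by end_near.
Qed.

Lemma cvg_divn_ratio (R : realType) (M : nat) : (0 < M)%N ->
  ((N %/ M)%:R / N%:R : R) @[N --> \oo] --> (M%:R^-1 : R).
Proof.
move=> M0; apply/cvgrPdist_le => e e0; near=> N.
have N0 : (0 < N)%N by near: N; exact: nbhs_infty_gt.
have N0R : 0 < N%:R :> R by rewrite ltr0n.
have M0R : 0 < M%:R :> R by rewrite ltr0n.
have Ne : 1 <= e * N%:R.
  by rewrite mulrC -ler_pdivrMr // div1r; near: N; exact: nbhs_infty_ger.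
(* The error is below [1 / N], because the remainder is below [M]. *)
rewrite (_ : _ - _ = (N %% M)%:R / (M%:R * N%:R)); last first.
  have -> : (N %% M)%:R = N%:R - (N %/ M)%:R * M%:R :> R.
    by rewrite [in N%:R](divn_eq N M) natrD natrM addrC addKr.
  by field; rewrite !gt_eqF.
rewrite ger0_norm ?divr_ge0 ?mulr_ge0 //.
rewrite ler_pdivrMr ?mulr_gt0 // mulrCA.
apply: (@le_trans _ _ M%:R); first by rewrite ler_nat ltnW // ltn_mod.
by rewrite ler_peMr // ltW.
Unshelve. all: by end_near.
Qed.

Theorem mainTheorem10 (R : realType) (M : nat) (M_ge1 : (1 <= M)%N) :
  ((xi_star M N)%:R / (xi_star 1 (N %/ M)%N)%:R : R) @[N --> \oo] --> (M%:R : R).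
Proof.
have M0 : M%:R != 0 :> R by rewrite pnatr_eq0 -lt0n.
(* The ratio is [u / (v * w)], with limit [(1 / 2) / ((1 / 2) * (1 / M)) = M]. *)
pose u N : R := (xi_star M N)%:R / N%:R.
pose v N : R := (xi_star 1 (N %/ M))%:R / (N %/ M)%:R.
pose w N : R := (N %/ M)%:R / N%:R.
have cu : u @ \oo --> (2^-1 : R) by exact: cvg_xi_star_div.
have cv : v @ \oo --> (2^-1 : R).
  exact: (cvg_comp _ _ (cvg_divn_infty _ M_ge1) (@cvg_xi_star_div R 1 isT)).
have cw : w @ \oo --> (M%:R^-1 : R) by exact: cvg_divn_ratio.
have -> : (M%:R : R) = 2^-1 * (2^-1 * M%:R^-1)^-1 by field.
have cvw : (fun N => v N * w N) @ \oo --> (2^-1 * M%:R^-1 : R) by exact: cvgM.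
have vw0 : 2^-1 * M%:R^-1 != 0 :> R by rewrite mulf_neq0 ?invr_eq0.
apply: cvg_trans (cvgM cu (cvgV vw0 cvw)).
(* The factorization is used for [N >= M], where [N] and [N %/ M] are nonzero and cancel. *)
apply: near_eq_cvg; near=> N.
have N0 : N%:R != 0 :> R.
  by rewrite pnatr_eq0 -lt0n; near: N; exact: nbhs_infty_gt.
have NM0 : (N %/ M)%:R != 0 :> R.
  by rewrite pnatr_eq0 -lt0n divn_gt0 //; near: N; exact: nbhs_infty_ge.
rewrite /u /v /w /= mulrA mulfVK // invfM invrK.
by rewrite mulrACA mulVf ?mulr1.
Unshelve. all: by end_near.
Qed.
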